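(* Let $V$ be the Malcev algebra of pure real octonions, i.e. the $7$-dimensional real vector space of trace-zero elements of the octonion division algebra $\mathbb{O}$ over $\mathbb{R}$, equipped with the product $vw=v\cdot w-w\cdot v$, where $\cdot$ is the octonion multiplication. Let $p(x_1,\dots,x_m)$ be an arbitrary polynomial in $m$ anticommuting variables over $\mathbb{R}$. Then the image $\{p(v_1,\dots,v_m): v_1,\dots,v_m\in V\}$, where $p$ is evaluated using the product of the Malcev algebra $V$, is either $\{0\}$ or $V$.
   Context: The real octonions are $\mathbb{O}=\mathbb{H}\oplus\mathbb{H}$ with $\mathbb{H}$ the real quaternions and multiplication $(a_1,a_2)\cdot(b_1,b_2)=(a_1b_1-b_2^*a_2,\; b_2a_1+a_2b_1^* )$, where $*$ is quaternion conjugation; the involution is $(a_1,a_2)^*=(a_1^*,-a_2)$ and the trace is $\operatorname{tr}(a)=\frac12(a+a^* )\in\mathbb{R}$. Pure octonions are the elements of trace $0$. The product $vw=v\cdot w-w\cdot v$ maps $V\times V$ to $V$ and satisfies $vw=-wv$. A polynomial in $m$ anticommuting variables is a finite real linear combination of (nonempty) nonassociative words in $x_1,\dots,x_m$, taken modulo the anticommutativity law $uv=-vu$ (an element of the free nonassociative anticommutative algebra without unit over $\mathbb{R}$). In particular there is no constant term, and coefficients are real. It is not assumed to be multilinear or homogeneous. *)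

(* Defs.v *)
From HB Require Import structures.
From mathcomp Require Import all_boot all_order all_algebra.
From mathcomp Require Import finmap ring boolp classical_sets reals.
From mathcomp Require Import monalg.

Set Implicit Arguments.
Unset Strict Implicit.
Unset Printing Implicit Defensive.

Import GRing.Theory.
Local Open Scope ring_scope.
Local Open Scope quotient_scope.

Section Quaternions.
Variable R : realType.

(* [Quat a b c d] is a + b i + c j + d k *)
Record quat := Quat {q0 : R; q1 : R; q2 : R; q3 : R}.

Definition quat_code (a : quat) := (q0 a, q1 a, q2 a, q3 a).
Definition quat_decode (t : R * R * R * R) :=
  let: (a, b, c, d) := t in Quat a b c d.
Lemma quat_codeK : cancel quat_code quat_decode. Proof. by case. Qed.
HB.instance Definition _ := Choice.copy quat (can_type quat_codeK).

Definition qzero := Quat 0 0 0 0.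
Definition qopp a := Quat (- q0 a) (- q1 a) (- q2 a) (- q3 a).
Definition qadd a b :=
  Quat (q0 a + q0 b) (q1 a + q1 b) (q2 a + q2 b) (q3 a + q3 b).
Definition qscale (t : R) a := Quat (t * q0 a) (t * q1 a) (t * q2 a) (t * q3 a).

Lemma qaddA : associative qadd.
Proof. by move=> a b c; rewrite /qadd /= !addrA. Qed.
Lemma qaddC : commutative qadd.
Proof. by move=> a b; congr Quat; exact: addrC. Qed.
Lemma qadd0 : left_id qzero qadd.
Proof. by case=> *; rewrite /qadd /= !add0r. Qed.
Lemma qaddN : left_inverse qzero qopp qadd.
Proof. by move=> a; rewrite /qadd /= !addNr. Qed.
HB.instance Definition _ := GRing.isZmodule.Build quat qaddA qaddC qadd0 qaddN.

Lemma qscaleA s t a : qscale s (qscale t a) = qscale (s * t) a.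
Proof. by rewrite /qscale /= !mulrA. Qed.
Lemma qscale1 : left_id 1 qscale.
Proof. by case=> *; rewrite /qscale /= !mul1r. Qed.
Lemma qscaleDr : right_distributive qscale +%R.
Proof. by move=> t a b; congr Quat; exact: mulrDr. Qed.
Lemma qscaleDl a : {morph qscale^~ a : s t / s + t}.
Proof. by move=> s t; congr Quat; exact: mulrDl. Qed.
HB.instance Definition _ := GRing.Zmodule_isLmodule.Build R quat
  qscaleA qscale1 qscaleDr qscaleDl.

Definition qmul a b := Quat
  (q0 a * q0 b - q1 a * q1 b - q2 a * q2 b - q3 a * q3 b)
  (q0 a * q1 b + q1 a * q0 b + q2 a * q3 b - q3 a * q2 b)
  (q0 a * q2 b - q1 a * q3 b + q2 a * q0 b + q3 a * q1 b)
  (q0 a * q3 b + q1 a * q2 b - q2 a * q1 b + q3 a * q0 b).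

Definition qconj a := Quat (q0 a) (- q1 a) (- q2 a) (- q3 a).

End Quaternions.

Section Octonions.
Variable R : realType.

Definition oct : Type := quat R * quat R.
HB.instance Definition _ := GRing.Lmodule.on oct.

Definition omul (a b : oct) : oct :=
  (qmul a.1 b.1 - qmul (qconj b.2) a.2, qmul b.2 a.1 + qmul a.2 (qconj b.1)).

Definition oconj (a : oct) : oct := (qconj a.1, - a.2).

Definition oreal (t : R) : oct := (Quat t 0 0 0, 0).

(* The trace is real, i.e. lies in the line spanned by 1: see [otrE]. *)
Definition otr (a : oct) : oct := 2^-1 *: (a + oconj a).

Lemma otrE a : otr a = oreal (q0 a.1).
Proof.
case: a => [[a b c d] a2]; congr pair; last by rewrite /= subrr scaler0.
by congr Quat => /=; field.
Qed.

Definition pure : {pred oct} := fun a => otr a == 0.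

Lemma pureE a : (a \in pure) = (q0 a.1 == 0).
Proof.
rewrite unfold_in otrE; apply/eqP/eqP => [[]//|->]; by [].
Qed.

Lemma pure_submod : submod_closed pure.
Proof.
split=> [|t a b]; first by rewrite pureE.
by rewrite !pureE /= => /eqP-> /eqP->; rewrite mulr0 addr0.
Qed.
HB.instance Definition _ := GRing.isSubmodClosed.Build R oct pure pure_submod.

Record pure_oct := PureOct {oct_of_pure :> oct; _ : oct_of_pure \in pure}.
HB.instance Definition _ := [isSub for oct_of_pure].
HB.instance Definition _ := [Choice of pure_oct by <:].
HB.instance Definition _ := [SubChoice_isSubLmodule of pure_oct by <:].

Definition ocomm (a b : oct) : oct := omul a b - omul b a.

Lemma ocomm_pure a b : ocomm a b \in pure.
Proof. by rewrite pureE /=; apply/eqP; ring. Qed.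

Definition malcev_mul (v w : pure_oct) : pure_oct := PureOct (ocomm_pure v w).

End Octonions.


Section AnticommutativePolynomials.
Variables (R : realType) (m : nat).

Inductive word := Var of 'I_m | Mul of word & word.

Fixpoint word_code (w : word) : GenTree.tree 'I_m :=
  match w with
  | Var i => GenTree.Leaf i
  | Mul u v => GenTree.Node 0 [:: word_code u; word_code v]
  end.
Fixpoint word_decode (t : GenTree.tree 'I_m) : option word :=
  match t with
  | GenTree.Leaf i => Some (Var i)
  | GenTree.Node 0 [:: s; t] =>
      if word_decode s is Some u then omap (Mul u) (word_decode t) else None
  | _ => None
  end.
Lemma word_codeK : pcancel word_code word_decode.
Proof. by elim=> //= u -> v ->. Qed.
HB.instance Definition _ := Choice.copy word (pcan_type word_codeK).

(* [{malg R[word]}] is the R-module of finitely supported functions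
   word -> R; with [free_mul] it is the free nonassociative algebra
   without unit on m generators. *)
Definition free_alg := {malg R[word]}.
HB.instance Definition _ := GRing.Lmodule.on free_alg.

Definition free_mul (f g : free_alg) : free_alg :=
  \sum_(u <- msupp f) \sum_(v <- msupp g) << f@_u * g@_v *g Mul u v >>.

(* The two-sided ideal generated by all f g + g f. *)
Inductive anticomm_ideal : free_alg -> Prop :=
| AnticommGen f g : anticomm_ideal (free_mul f g + free_mul g f)
| AnticommAdd f g :
    anticomm_ideal f -> anticomm_ideal g -> anticomm_ideal (f + g)
| AnticommScale (t : R) f : anticomm_ideal f -> anticomm_ideal (t *: f)
| AnticommMulL f g : anticomm_ideal g -> anticomm_ideal (free_mul f g)
| AnticommMulR f g : anticomm_ideal f -> anticomm_ideal (free_mul f g).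

Definition anticomm : {pred free_alg} := fun f => `[< anticomm_ideal f >].

Lemma anticomm_zmod : zmod_closed anticomm.
Proof.
split=> [|f g /asboolP fI /asboolP gI]; apply/asboolP.
  by rewrite -(scale0r (free_mul 0 0 + free_mul 0 0)); do 2?constructor.
by rewrite -scaleN1r; apply: AnticommAdd => //; apply: AnticommScale.
Qed.
HB.instance Definition _ := GRing.isZmodClosed.Build free_alg anticomm
  anticomm_zmod.

Definition anticomm_poly : Type := Quotient.quot anticomm.

Section Evaluation.
Variables (A : lmodType R) (mul : A -> A -> A) (x : 'I_m -> A).

Fixpoint word_eval (w : word) : A :=
  match w with
  | Var i => x i
  | Mul u v => mul (word_eval u) (word_eval v)
  end.

Definition free_eval (f : free_alg) : A :=
  \sum_(w <- msupp f) f@_w *: word_eval w.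

(* For a bilinear anticommutative product this does not depend on the
   representative: see [poly_eval_pi] and [malcev_eval_pi]. *)
Definition poly_eval (p : anticomm_poly) : A := free_eval (repr p).

Lemma free_evalEw (d : {fset word}) f : (msupp f `<=` d)%fset ->
  free_eval f = \sum_(w <- d) f@_w *: word_eval w.
Proof.
move=> fd; rewrite /free_eval (big_fset_incl _ fd) //= => w _ /mcoeff_outdom->.
by rewrite scale0r.
Qed.

Lemma free_evalU c w : free_eval << c *g w >> = c *: word_eval w.
Proof.
by rewrite (free_evalEw msuppU_le) big_seq_fset1 mcoeffUU.
Qed.

Lemma free_evalP : linear free_eval.
Proof.
move=> t f g.
have sf : (msupp f `<=` msupp f `|` msupp g)%fset by exact: fsubsetUl.
have sg : (msupp g `<=` msupp f `|` msupp g)%fset by exact: fsubsetUr.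
have st : (msupp (t *: f + g) `<=` msupp f `|` msupp g)%fset.
  by apply: fsubset_trans (msuppD_le _ _) _; apply/fsetSU/msuppZ_le.
rewrite (free_evalEw sf) (free_evalEw sg) (free_evalEw st) scaler_sumr.
rewrite -big_split /=; apply: eq_bigr => w _.
by rewrite mcoeffD mcoeffZ scalerDl scalerA.
Qed.
HB.instance Definition _ :=
  GRing.isLinear.Build R free_alg A _ free_eval free_evalP.

Hypothesis mul_linearl : forall b, linear (mul^~ b).
Hypothesis mul_linearr : forall a, linear (mul a).
Hypothesis mulN : forall a b, mul a b = - mul b a.

Lemma free_evalM f g : free_eval (free_mul f g) = mul (free_eval f) (free_eval g).
Proof.
pose Ml b : {linear A -> A} :=
  HB.pack (mul^~ b) (GRing.isLinear.Build _ _ _ _ _ (mul_linearl b)).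
pose Mr a : {linear A -> A} :=
  HB.pack (mul a) (GRing.isLinear.Build _ _ _ _ _ (mul_linearr a)).
have -> : mul (free_eval f) (free_eval g) = Ml (free_eval g) (free_eval f) by [].
rewrite [in RHS]/free_eval !linear_sum; apply: eq_bigr => u _.
rewrite linearZ /= [LHS]linear_sum.
have -> : mul (word_eval u) (free_eval g) = Mr (word_eval u) (free_eval g) by [].
rewrite [in RHS]/free_eval [in RHS]linear_sum scaler_sumr; apply: eq_bigr => v _.
by rewrite linearZ /= free_evalU scalerA.
Qed.

Lemma free_eval_anticomm f : f \in anticomm -> free_eval f = 0.
Proof.
pose Ml b : {linear A -> A} :=
  HB.pack (mul^~ b) (GRing.isLinear.Build _ _ _ _ _ (mul_linearl b)).
pose Mr a : {linear A -> A} :=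
  HB.pack (mul a) (GRing.isLinear.Build _ _ _ _ _ (mul_linearr a)).
move=> /asboolP; elim=> {f} [f g|f g _ IHf _ IHg|t f _ IHf|f g _ IHg|f g _ IHf].
- by rewrite linearD /= !free_evalM mulN addNr.
- by rewrite linearD /= IHf IHg addr0.
- by rewrite linearZ /= IHf scaler0.
- by rewrite free_evalM IHg; exact: (linear0 (Mr _)).
- by rewrite free_evalM IHf; exact: (linear0 (Ml _)).
Qed.

Lemma poly_eval_pi f : poly_eval (\pi f) = free_eval f.
Proof.
apply/eqP; rewrite -subr_eq0 -linearB; apply/eqP/free_eval_anticomm.
by rewrite Quotient.idealrBE reprK.
Qed.

End Evaluation.
End AnticommutativePolynomials.

Section MalcevBilinear.
Variable R : realType.
Implicit Types a b : pure_oct R.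

Lemma malcev_mulN a b : malcev_mul a b = - malcev_mul b a.
Proof. by apply: val_inj; rewrite /= /ocomm opprB. Qed.

Lemma malcev_mul_linearr a : linear (malcev_mul a).
Proof.
move=> t b c; apply: val_inj; congr pair; congr Quat => /=; ring.
Qed.

Lemma malcev_mul_linearl b : linear (fun a => malcev_mul a b).
Proof.
by move=> t a c; rewrite !(malcev_mulN _ b) malcev_mul_linearr opprD scalerN.
Qed.

Lemma malcev_eval_pi m (v : 'I_m -> pure_oct R) (f : free_alg R m) :
  poly_eval (@malcev_mul R) v (\pi f) = free_eval (@malcev_mul R) v f.
Proof.
apply: poly_eval_pi; [exact: malcev_mul_linearl | exact: malcev_mul_linearr |].
exact: malcev_mulN.
Qed.

End MalcevBilinear.

(* Main.v *)
From HB Require Import structures.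
Require Import Defs.
From mathcomp Require Import all_boot all_order all_algebra.
From mathcomp Require Import boolp classical_sets reals.
From mathcomp Require Import finmap ring lra polyrcf monalg.

(** The image of p is invariant under every automorphism of V, since an
    automorphism commutes with evaluation ([morph_free_eval]).  The
    automorphism group G2 of the octonions is transitive on each sphere of V
    centred at 0 ([malcev_reach_sphere]), so the image is determined by the
    set of norms of its elements.

    Suppose that p takes a nonzero value at v.  Along the line t |-> t v the
    squared norm of p(t v) is a polynomial in t; every word has positive
    degree, so this polynomial vanishes at t = 0, but it does not at t = 1.
    Being nonnegative and nonconstant it tends to infinity, and the
    intermediate value theorem shows that it takes every nonnegative value
    ([nonneg_poly_onto]).  Hence the image meets every sphere, and is V.

    Transitivity on spheres needs only two kinds of automorphisms of the
    octonions H + H: the maps (a, b) |-> (a, p b) for a unit quaternion p, and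
    one permutation of the seven imaginary units in a single cycle.  The first
    kind replaces b by any quaternion of the same norm, in particular by a
    real one.  Thus the last four coordinates collapse to one; the cycle moves
    two of the remaining first three coordinates next to it, and after a
    second collapse the two surviving coordinates are moved together, so that
    a third collapse leaves a vector on a fixed axis. *)

Set Implicit Arguments.
Unset Strict Implicit.
Unset Printing Implicit Defensive.

Import Order.TTheory GRing.Theory Num.Theory.

Local Open Scope classical_set_scope.
Local Open Scope ring_scope.

(** * Real polynomials *)

Lemma nonneg_poly_onto (R : rcfType) (P : {poly R}) (s : R) :
  (forall t, 0 <= P.[t]) -> P.[0] = 0 -> P.[s] != 0 ->
  forall r, 0 <= r -> exists t, P.[t] = r.
Proof.
move=> P_ge0 P0 Ps r r_ge0.
have P_neq0 : P != 0 by apply: contraNneq Ps => ->; rewrite horner0.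
have sizeP : (1 < size P)%N.
  rewrite ltnNge; apply: contra Ps => /size1_polyC eqP.
  by move: P0; rewrite eqP !hornerC => ->.
have lead_gt0 : 0 < lead_coef P.
  rewrite lt_neqAle eq_sym lead_coef_eq0 P_neq0 leNgt; apply/negP => lead_lt0.
  (* Otherwise - P would tend to infinity and P would take negative values. *)
  have [||x /(_ x (lexx x))] := @poly_lim_infty _ (- P) 1.
  - by rewrite lead_coefN oppr_gt0.
  - by rewrite size_polyN.
  by rewrite hornerN; have := P_ge0 x; lra.
have [b b_ge] := poly_lim_infty r lead_gt0 sizeP.
have [||t _ /rootP] := @poly_ivt _ (P - r%:P) 0 (Num.max b 0).
- by rewrite le_max lexx orbT.
- rewrite !hornerE P0 sub0r oppr_le0 r_ge0 subr_ge0.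
  by apply: b_ge; rewrite le_max lexx.
by rewrite !hornerE => /eqP; rewrite subr_eq0 => /eqP; exists t.
Qed.

(** * Evaluation of words *)

Section Words.
Variables (R : realType) (m : nat).

Lemma morph_free_eval (A B : lmodType R) (mulA : A -> A -> A)
    (mulB : B -> B -> B) (f : {linear A -> B}) (x : 'I_m -> A)
    (F : free_alg R m) :
  {morph f : a b / mulA a b >-> mulB a b} ->
  f (free_eval mulA x F) = free_eval mulB (f \o x) F.
Proof.
move=> fM; rewrite /free_eval linear_sum; apply: eq_bigr => w _.
rewrite linearZ; congr (_ *: _).
by elim: w => //= u IHu v IHv; rewrite fM IHu IHv.
Qed.

Fixpoint degree (w : word m) : nat :=
  match w with Var _ => 1 | Mul u v => degree u + degree v end.

Lemma degree_gt0 (w : word m) : (0 < degree w)%N.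
Proof. by elim: w => //= u u_gt0 v _; rewrite addn_gt0 u_gt0. Qed.

Lemma word_eval_scale (A : lmodType R) (mul : A -> A -> A) (x : 'I_m -> A)
    (t : R) (w : word m) :
  (forall b, linear (mul^~ b)) -> (forall a, linear (mul a)) ->
  word_eval mul (fun i => t *: x i) w = t ^+ degree w *: word_eval mul x w.
Proof.
move=> mull mulr.
pose Ml b : {linear A -> A} :=
  HB.pack (mul^~ b) (GRing.isLinear.Build _ _ _ _ _ (mull b)).
pose Mr a : {linear A -> A} :=
  HB.pack (mul a) (GRing.isLinear.Build _ _ _ _ _ (mulr a)).
elim: w => //= u -> v ->.
have -> : mul (t ^+ degree u *: word_eval mul x u)
    (t ^+ degree v *: word_eval mul x v)
  = Ml (t ^+ degree v *: word_eval mul x v)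
      (t ^+ degree u *: word_eval mul x u) by [].
rewrite linearZ /= -[mul _ _]/(Mr _ _) linearZ /=.
by rewrite scalerA exprD.
Qed.

(** A word of degree d is homogeneous of degree d in the scaling parameter, so
    the coefficients of the polynomial are read off word by word; it vanishes
    at 0 because no word has degree 0. *)
Lemma scalar_free_eval_poly (A : lmodType R) (mul : A -> A -> A)
    (x : 'I_m -> A) (F : free_alg R m) (l : {scalar A}) :
  (forall b, linear (mul^~ b)) -> (forall a, linear (mul a)) ->
  exists2 P : {poly R}, P.[0] = 0 &
    forall t, l (free_eval mul (fun i => t *: x i) F) = P.[t].
Proof.
move=> mull mulr.
exists (\sum_(w <- msupp F) (F@_w * l (word_eval mul x w)) *: 'X^(degree w)).
  rewrite horner_sum big1 // => w _; rewrite hornerZ hornerXn.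
  by rewrite expr0n -[_ == _]negbK -lt0n degree_gt0 mulr0.
move=> t; rewrite horner_sum linear_sum; apply: eq_bigr => w _.
rewrite word_eval_scale // scalerA linearZ /= hornerZ hornerXn.
by rewrite mulrAC.
Qed.

End Words.

(** * Quaternions *)

Section QuaternionTheory.
Variable R : realType.
Implicit Types a b c p : quat R.

Definition qnorm2 a := q0 a ^+ 2 + q1 a ^+ 2 + q2 a ^+ 2 + q3 a ^+ 2.

Lemma quat_eqP a b :
  [/\ q0 a = q0 b, q1 a = q1 b, q2 a = q2 b & q3 a = q3 b] -> a = b.
Proof. by case: a b => a0 a1 a2 a3 [b0 b1 b2 b3] /= [-> -> -> ->]. Qed.

Lemma qmulA : associative (@qmul R).
Proof. by move=> a b c; congr Quat => /=; ring. Qed.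

Lemma qmul_linear a : linear (qmul a).
Proof. by move=> t b c; congr Quat => /=; ring. Qed.
HB.instance Definition _ a :=
  GRing.isLinear.Build R (quat R) (quat R) _ (qmul a) (qmul_linear a).

Lemma qconjM a b : qconj (qmul a b) = qmul (qconj b) (qconj a).
Proof. by congr Quat => /=; ring. Qed.

Lemma qconj_mul_cancel p a : qnorm2 p = 1 -> qmul (qconj p) (qmul p a) = a.
Proof.
move=> p1; rewrite -[RHS]scale1r -p1 /qnorm2; case: a => a0 a1 a2 a3.
by congr Quat => /=; ring.
Qed.

Lemma qnorm2_eq0 a : qnorm2 a = 0 -> a = 0.
Proof.
case: a => a b c d; rewrite /qnorm2 /= => N0.
by apply: quat_eqP; split=> /=; nra.
Qed.

(** For b nonzero, p is b' b^-1, with b^-1 = qconj b / qnorm2 b. *)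
Lemma qnorm2_transitive b b' :
  qnorm2 b = qnorm2 b' -> exists2 p, qnorm2 p = 1 & qmul p b = b'.
Proof.
move=> eqN; have [b0|b_neq0] := eqVneq (qnorm2 b) 0.
  have b'0 : b' = 0 by apply: qnorm2_eq0; rewrite -eqN.
  exists (Quat 1 0 0 0); first by rewrite /qnorm2 /=; ring.
  by rewrite (qnorm2_eq0 b0) b'0 linear0.
exists ((qnorm2 b)^-1 *: qmul b' (qconj b)).
  apply: (@mulfI _ (qnorm2 b ^+ 2)); first by rewrite expf_neq0.
  rewrite mulr1 expr2 {4}eqN; move: b_neq0; rewrite /qnorm2 /= => b_neq0.
  by field.
apply: (@scalerI _ _ (qnorm2 b)) => //.
move: b_neq0; rewrite /qnorm2 => b_neq0.
by apply: quat_eqP; split=> /=; field.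
Qed.

End QuaternionTheory.

(** * Automorphisms and spheres *)

Section Automorphisms.
Variable R : realType.
Implicit Types (x y z : pure_oct R) (p b : quat R).

(** An endomorphism instead of an automorphism is enough to transport values of
    a polynomial from x to y; inverses enter only through the symmetric
    relation [malcev_equiv]. *)
Definition malcev_reach x y : Prop :=
  exists f : {linear pure_oct R -> pure_oct R},
    {morph f : u v / malcev_mul u v} /\ f x = y.

Lemma malcev_reach_trans x y z :
  malcev_reach x y -> malcev_reach y z -> malcev_reach x z.
Proof.
move=> [f [fM <-]] [g [gM <-]]; exists (g \o f); split=> // u v /=.
by rewrite fM gM.
Qed.

Definition malcev_equiv x y := malcev_reach x y /\ malcev_reach y x.

Lemma malcev_equiv_trans x y z :
  malcev_equiv x y -> malcev_equiv y z -> malcev_equiv x z.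
Proof.
by move=> [xy yx] [yz zy]; split; apply: malcev_reach_trans; eassumption.
Qed.

Lemma oct_morph_reach (f : {linear oct R -> oct R}) x y :
  {morph f : a b / omul a b} -> (forall a, q0 (f a).1 = q0 a.1) ->
  f (x : oct R) = (y : oct R) -> malcev_reach x y.
Proof.
move=> fM f0 fxy.
have f_pure a : a \in @pure R -> f a \in @pure R by rewrite !pureE f0.
pose g (u : pure_oct R) : pure_oct R := PureOct (f_pure _ (valP u)).
have g_linear : linear g by move=> t u v; apply: val_inj; exact: linearP.
pose G : {linear pure_oct R -> pure_oct R} :=
  HB.pack g (GRing.isLinear.Build _ _ _ _ _ g_linear).
exists G; split=> [u v|]; apply: val_inj => //=.
by rewrite /ocomm linearB !fM.
Qed.

Definition mul_snd p (a : oct R) : oct R := (a.1, qmul p a.2).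

Lemma mul_snd_linear p : linear (mul_snd p).
Proof. by move=> t a b; rewrite /mul_snd /= linearP. Qed.
HB.instance Definition _ p :=
  GRing.isLinear.Build R (oct R) (oct R) _ (mul_snd p) (mul_snd_linear p).

(** In the first component of a product p occurs only as qconj p * p = 1; in the
    second, each summand is a left multiple of a second component, from which
    p factors out by associativity. *)
Lemma mul_snd_morph p : qnorm2 p = 1 -> {morph mul_snd p : a b / omul a b}.
Proof.
move=> p1 a b; rewrite /mul_snd /omul /=.
by rewrite qconjM -qmulA qconj_mul_cancel // linearD /= !qmulA.
Qed.

Lemma mul_snd_reach x y :
  (x : oct R).1 = (y : oct R).1 ->
  qnorm2 (x : oct R).2 = qnorm2 (y : oct R).2 -> malcev_reach x y.
Proof.
move=> xy1 /qnorm2_transitive[p p1 pxy].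
apply: (@oct_morph_reach (mul_snd p)) => //; first exact: mul_snd_morph.
by rewrite /= /mul_snd pxy xy1; case: (y : oct R).
Qed.

Lemma mul_snd_equiv x y :
  (x : oct R).1 = (y : oct R).1 ->
  qnorm2 (x : oct R).2 = qnorm2 (y : oct R).2 -> malcev_equiv x y.
Proof. by move=> xy1 xy2; split; apply: mul_snd_reach. Qed.

(** Numbering the imaginary units e1, e2, e3 in the first summand and
    e4, ..., e7 in the second, this permutes them along the cycle
    e1, e2, e4, e5, e7, e3, e6, without any sign. *)
Definition cyc (a : oct R) : oct R :=
  (Quat (q0 a.1) (q2 a.2) (q1 a.1) (q3 a.2),
   Quat (q2 a.1) (q0 a.2) (q3 a.1) (q1 a.2)).

Definition cyc_inv (a : oct R) : oct R :=
  (Quat (q0 a.1) (q2 a.1) (q0 a.2) (q2 a.2),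
   Quat (q1 a.2) (q3 a.2) (q1 a.1) (q3 a.1)).

Lemma cyc_linear : linear cyc.
Proof. by []. Qed.
HB.instance Definition _ :=
  GRing.isLinear.Build R (oct R) (oct R) _ cyc cyc_linear.

Lemma cyc_inv_linear : linear cyc_inv.
Proof. by []. Qed.
HB.instance Definition _ :=
  GRing.isLinear.Build R (oct R) (oct R) _ cyc_inv cyc_inv_linear.

Lemma cycK : cancel cyc cyc_inv.
Proof. by case=> [[? ? ? ?] [? ? ? ?]]. Qed.

Lemma cyc_morph : {morph cyc : a b / omul a b}.
Proof. by move=> a b; congr pair; congr Quat => /=; ring. Qed.

Lemma cyc_inv_morph : {morph cyc_inv : a b / omul a b}.
Proof. by move=> a b; congr pair; congr Quat => /=; ring. Qed.

Lemma cyc_equiv x y : cyc x = y -> malcev_equiv x y.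
Proof.
move=> xy; split.
  by apply: (@oct_morph_reach cyc) => //; exact: cyc_morph.
apply: (@oct_morph_reach cyc_inv) => //; first exact: cyc_inv_morph.
by rewrite /= -xy cycK.
Qed.

Lemma imaginary_pure (a1 a2 a3 : R) b : (Quat 0 a1 a2 a3, b) \in @pure R.
Proof. by rewrite pureE. Qed.

Definition mk_pure (a1 a2 a3 : R) b := PureOct (imaginary_pure a1 a2 a3 b).

Definition norm2 x := qnorm2 (x : oct R).1 + qnorm2 (x : oct R).2.

Lemma norm2_ge0 x : 0 <= norm2 x.
Proof. by rewrite /norm2 /qnorm2 !addr_ge0 // sqr_ge0. Qed.

Lemma norm2_eq0 x : norm2 x = 0 -> x = 0.
Proof.
case: x => [[a b] ab_pure] /eqP.
rewrite /norm2 /= paddr_eq0 /qnorm2 ?addr_ge0 ?sqr_ge0 //.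
move=> /andP[/eqP Na /eqP Nb].
by apply: val_inj; rewrite /= (qnorm2_eq0 Na) (qnorm2_eq0 Nb).
Qed.

(** Collapses the last four coordinates to one, by rotating b to a real
    quaternion of the same norm. *)
Lemma mk_pure_concentrate (a1 a2 a3 : R) b :
  malcev_equiv (mk_pure a1 a2 a3 b)
               (mk_pure a1 a2 a3 (Quat (Num.sqrt (qnorm2 b)) 0 0 0)).
Proof.
apply: mul_snd_equiv => //=; rewrite [RHS]/qnorm2 /= sqr_sqrtr; first ring.
by rewrite /qnorm2 !addr_ge0 // sqr_ge0.
Qed.

(** Collapse, cycle, collapse, cycle, collapse: the cycle e1, e2, e4, e5, e7,
    e3, e6 sends e2, e3, e4 into the second summand and e1 to e2, and then e2
    and e4 both into the second summand. *)
Lemma malcev_equiv_axis x :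
  malcev_equiv x (mk_pure 0 0 0 (Quat (Num.sqrt (norm2 x)) 0 0 0)).
Proof.
case: x => [[[a0 a1 a2 a3] b] a_pure].
have a0E : a0 = 0 by move: a_pure; rewrite pureE => /eqP.
subst a0; have -> : PureOct a_pure = mk_pure a1 a2 a3 b by exact: val_inj.
apply: malcev_equiv_trans (mk_pure_concentrate _ _ _ _) _.
set r := Num.sqrt _.
apply: malcev_equiv_trans
  (_ : malcev_equiv _ (mk_pure 0 a1 0 (Quat a2 r a3 0))) _.
  exact: cyc_equiv.
apply: malcev_equiv_trans (mk_pure_concentrate _ _ _ _) _.
set s := Num.sqrt _.
apply: malcev_equiv_trans
  (_ : malcev_equiv _ (mk_pure 0 0 0 (Quat a1 s 0 0))) _.
  exact: cyc_equiv.
apply: malcev_equiv_trans (mk_pure_concentrate _ _ _ _) _.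
suff -> : qnorm2 (Quat a1 s 0 0) = norm2 (mk_pure a1 a2 a3 b).
  by split; exists idfun.
have r2 : r ^+ 2 = qnorm2 b.
  by rewrite sqr_sqrtr // /qnorm2 !addr_ge0 // sqr_ge0.
have s2 : s ^+ 2 = qnorm2 (Quat a2 r a3 0).
  by rewrite sqr_sqrtr // /qnorm2 !addr_ge0 // sqr_ge0.
rewrite /norm2 {1}/qnorm2 /= s2 {1}/qnorm2 /= r2.
by rewrite [qnorm2 (Quat _ _ _ _)]/qnorm2 /=; ring.
Qed.

Lemma malcev_reach_sphere x y : norm2 x = norm2 y -> malcev_reach x y.
Proof.
move=> Nxy; apply: malcev_reach_trans (malcev_equiv_axis x).1 _.
by rewrite Nxy; exact: (malcev_equiv_axis y).2.
Qed.

End Automorphisms.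

(** * The norm along a line *)

Section NormAlongLine.
Variables (R : realType) (m : nat) (F : free_alg R m) (v : 'I_m -> pure_oct R).

Lemma norm2_free_eval_poly :
  exists2 P : {poly R}, P.[0] = 0 &
    forall t, norm2 (free_eval (@malcev_mul R) (fun i => t *: v i) F) = P.[t].
Proof.
pose poly_along (f : pure_oct R -> R) := exists2 P : {poly R}, P.[0] = 0 &
  forall t, f (free_eval (@malcev_mul R) (fun i => t *: v i) F) = P.[t].
have sumP f g :
    poly_along f -> poly_along g -> poly_along (fun x => f x + g x).
  move=> [P P0 fP] [Q Q0 gQ]; exists (P + Q) => [|t].
    by rewrite hornerD P0 Q0 addr0.
  by rewrite fP gQ hornerD.
have sqrP (l : pure_oct R -> R) :
    scalar l -> poly_along (fun x => l x ^+ 2).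
  move=> l_linear.
  pose L : {scalar pure_oct R} :=
    HB.pack l (GRing.isLinear.Build _ _ _ _ _ l_linear).
  have [||P P0 lP] := @scalar_free_eval_poly R m _ (@malcev_mul R) v F L.
  - exact: malcev_mul_linearl.
  - exact: malcev_mul_linearr.
  exists (P ^+ 2) => [|t]; first by rewrite horner_exp P0 expr0n.
  by rewrite horner_exp -lP.
suff: poly_along (@norm2 R) by [].
rewrite /norm2 /qnorm2.
by do !apply: (sumP); apply: (sqrP).
Qed.

End NormAlongLine.

(** * The image of a polynomial *)

Theorem theorem5p1 (R : realType) (m : nat) (p : anticomm_poly R m) :
  let image := range (fun v : 'I_m -> pure_oct R => poly_eval (@malcev_mul R) v p) in
  image = [set 0] \/ image = [set: pure_oct R].
Proof.
rewrite /poly_eval; set F := repr p; set ev := fun v => _.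
have [[v ev_v]|ev0] := pselect (exists v, ev v <> 0); last first.
  left; apply/seteqP; split=> [_ [v _ <-]|_ ->] /=.
    by apply: contrapT => ev_v; apply: ev0; exists v.
  exists (fun=> 0) => //; apply: contrapT => ev_0.
  by apply: ev0; eexists; exact: ev_0.
right; apply/seteqP; split=> // y _.
have [P P0 NP] := @norm2_free_eval_poly R m F v.
have [||t Pt] := @nonneg_poly_onto R P 1 _ P0 _ (norm2 y) (norm2_ge0 y).
- by move=> t; rewrite -NP norm2_ge0.
- rewrite -NP; apply/eqP => /norm2_eq0; apply: contra_not ev_v.
  by under [fun i => 1 *: v i]funext do rewrite scale1r.
have [f [fM <-]] : malcev_reach (ev (fun i => t *: v i)) y.
  by apply: malcev_reach_sphere; rewrite NP.
exists (f \o (fun i => t *: v i)) => //.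
by rewrite /ev -(morph_free_eval _ _ fM).
Qed.
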